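(* Let $q\ge 1$ be an integer, let $\tau_q\ge\dots\ge\tau_1>0$, and consider the time-delay system $$\dot x(t)=f(x(t),x(t-\tau_1),\dots,x(t-\tau_q))+g(x(t))u(t),\quad y(t)=h(x(t)),\quad t\ge 0,\qquad x(t)=\phi(t),\ t\in[-\tau_q,0],$$ with state $x(t)\in\mathbb{R}^n$, input $u(t)\in\mathbb{R}^m$, output $y(t)\in\mathbb{R}^m$, where $f:\mathbb{R}^{n(q+1)}\to\mathbb{R}^n$ and $g:\mathbb{R}^n\to\mathbb{R}^{n\times m}$ are locally Lipschitz continuous and $h:\mathbb{R}^n\to\mathbb{R}^m$. Consider the quadratic supply rate $$s(y,u)=\begin{bmatrix}y\\ u\end{bmatrix}^\top\begin{bmatrix}S_{11}&S_{12}\\S_{12}^\top&S_{22}\end{bmatrix}\begin{bmatrix}y\\ u\end{bmatrix},\qquad S_{11}=S_{11}^\top,\ S_{22}=S_{22}^\top,\ S_{11},S_{12},S_{22}\in\mathbb{R}^{m\times m}.$$ If there exists a function $\mathcal{S}$ of the form $$\mathcal{S}(x_t)=\mathcal{S}_1(x(t))+\sum_{i=1}^q\int_{t-\tau_i}^t\Theta_i(x(s))\,ds$$ with $\mathcal{S}(0)=0$, where $\mathcal{S}_1:\mathbb{R}^n\to[0,\infty)$ is continuously differentiable and $\Theta_i:\mathbb{R}^n\to[0,\infty)$, $i=1,\dots,q$, are continuous positive semidefinite functions, such that for all $x_0,x_1,\dots,x_q\in\mathbb{R}^n$ the symmetric matrix $$\begin{bmatrix}\Psi_{xx}(x_0,x_1,\dots,x_q)&\Psi_{xu}(x_0)\\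 \Psi_{xu}(x_0)^\top&\Psi_{uu}(x_0)\end{bmatrix}$$ is negative semidefinite, where $$\Psi_{xx}(x_0,x_1,\dots,x_q)=\nabla\mathcal{S}_1(x_0)^\top f(x_0,x_1,\dots,x_q)+\sum_{i=1}^q\Theta_i(x_0)-\sum_{i=1}^q\Theta_i(x_i)-h(x_0)^\top S_{11}h(x_0),$$ $$\Psi_{xu}(x_0)=\tfrac12\nabla\mathcal{S}_1(x_0)^\top g(x_0)-h(x_0)^\top S_{12},\qquad \Psi_{uu}(x_0)=-S_{22},$$ then the system is dissipative with respect to the supply rate $s$.
   Context: Notation: $x_t(\theta)=x(t+\theta)$ for $\theta\in[-\tau_q,0]$. Dissipativity: the system with delays $\tau_q\ge\dots\ge\tau_1>0$ is dissipative with respect to a continuous supply rate $s:\mathbb{R}^m\times\mathbb{R}^m\to\mathbb{R}$ if there is a storage function $\mathcal{S}:C^1([-\tau_q,0],\mathbb{R}^n)\to[0,\infty)$ with $\mathcal{S}(0)=0$ such that $$\mathcal{S}(x_{t_1})-\mathcal{S}(x_{t_0})\le\int_{t_0}^{t_1}s(y(r),u(r))\,dr\qquad\text{for all }0\le t_0\le t_1<\infty$$ and all initial histories $\phi\in C^1([-\tau_q,0],\mathbb{R}^n)$ (and all admissible inputs $u$), where $x$ is the solution of the system with history $\phi$ and $y$ is the corresponding output. *)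

(* Defs.v *)
From mathcomp Require Import all_boot all_order all_algebra.
From mathcomp Require Import all_classical all_reals all_analysis.

Set Implicit Arguments.
Unset Strict Implicit.
Unset Printing Implicit Defensive.

Import Order.TTheory GRing.Theory Num.Theory.
Import numFieldNormedType.Exports.

Local Open Scope classical_set_scope.
Local Open Scope ring_scope.

Section real_functions.
Variable R : realType.

Definition locally_lipschitz (V W : normedModType R) (F : V -> W) : Prop :=
  forall x : V, exists2 U : set V, nbhs x U & [lipschitz F z | z in U].

Definition gradient n (F : 'cV[R]_n -> R) (x : 'cV[R]_n) : 'cV[R]_n :=
  \col_i 'D_(delta_mx i 0) F x.

Definition continuously_differentiable n (F : 'cV[R]_n -> R) : Prop :=
  (forall x, differentiable F x) /\ continuous (gradient F).

Definition pos_semidef_fun n (F : 'cV[R]_n -> R) : Prop :=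
  F 0 = 0 /\ forall x, 0 <= F x.

Definition neg_semidef_mx n (M : 'M[R]_n) : Prop :=
  forall v : 'cV[R]_n, (v^T *m M *m v) 0 0 <= 0.

(** Absolute continuity on [[a, b]]. *)
Definition abs_continuous (V : normedModType R) (a b : R) (F : R -> V) : Prop :=
  forall e : R, 0 < e -> exists2 d : R, 0 < d &
    forall (k : nat) (l r : 'I_k -> R),
      (forall i, a <= l i /\ l i <= r i /\ r i <= b) ->
      trivIset setT (fun i => `]l i, r i[%classic) ->
      \sum_(i < k) (r i - l i) < d ->
      \sum_(i < k) `|F (r i) - F (l i)| < e.

(** Membership in C^1([[a, b]]) of the restriction of [F]: by the mean value
    theorem, [dF a] and [dF b] are then the one-sided derivatives of [F]. *)
Definition C1_on (V : normedModType R) (a b : R) (F : R -> V) : Prop :=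
  exists dF : R -> V,
    [/\ {within `[a, b], continuous F}, {within `[a, b], continuous dF}
      & forall t, a < t < b -> is_derive t 1 F (dF t)].

End real_functions.

(** The delays are [tau 0 <= ... <= tau q], so that there are [q.+1] of them and
    [tau ord_max] is the largest one.  The argument of [f] is the matrix whose
    columns are the current state followed by the [q.+1] delayed states. *)
Section delay_systems.
Variables (R : realType) (n m q : nat).
Variable tau : 'I_q.+1 -> R.

Local Notation mu := (@lebesgue_measure R).
Local Notation maxdelay := (tau ord_max).

(** [history x t] is x_t; only its restriction to [[- maxdelay, 0]] matters. *)
Definition history (x : R -> 'cV[R]_n) (t : R) : R -> 'cV[R]_n :=
  fun theta => x (t + theta).

Definition delayed_states (x : R -> 'cV[R]_n) (t : R) : 'M[R]_(n, q.+1) :=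
  \matrix_(k, i) x (t - tau i) k 0.

(** L^1_loc([[0, +oo[[; R^m). *)
Definition admissible_input (u : R -> 'cV[R]_m) : Prop :=
  forall (j : 'I_m) (b : R), 0 <= b ->
    mu.-integrable `[0, b] (fun r => (u r j 0)%:E).

(** [x] is a Caratheodory solution on [[- maxdelay, T[[ with history [phi] and
    input [u]; [T = +oo] is allowed, a finite [T] covers finite escape times. *)
Definition solution (f : 'M[R]_(n, 1 + q.+1) -> 'cV[R]_n)
    (g : 'cV[R]_n -> 'M[R]_(n, m)) (phi : R -> 'cV[R]_n) (u : R -> 'cV[R]_m)
    (T : \bar R) (x : R -> 'cV[R]_n) : Prop :=
  [/\ forall t, - maxdelay <= t <= 0 -> x t = phi t,
      forall b, 0 <= b -> (b%:E < T)%E -> abs_continuous 0 b x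
    & {ae mu, forall t, 0 < t -> (t%:E < T)%E ->
        is_derive t 1 x (f (row_mx (x t) (delayed_states x t))
                         + g (x t) *m u t)}].

(** The state [x_t] of a solution is in general not C^1 across [t = 0], whence
    storage functions are defined on continuous histories.  They are encoded as
    functionals on [R -> R^n] that only depend on the restriction of their
    argument to [[- maxdelay, 0]].  The right-hand side of the dissipation
    inequality is an extended real: for [u] only locally integrable, it may be
    [+oo]. *)
Definition dissipative (f : 'M[R]_(n, 1 + q.+1) -> 'cV[R]_n)
    (g : 'cV[R]_n -> 'M[R]_(n, m)) (h : 'cV[R]_n -> 'cV[R]_m)
    (s : 'cV[R]_m -> 'cV[R]_m -> R) : Prop :=
  exists S : (R -> 'cV[R]_n) -> R,
    [/\ forall phi psi, {in `[- maxdelay, 0], phi =1 psi} -> S phi = S psi,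
        forall phi, {within `[- maxdelay, 0], continuous phi} -> 0 <= S phi,
        S (fun=> 0) = 0
      & forall phi u T x,
          C1_on (- maxdelay) 0 phi -> admissible_input u ->
          solution f g phi u T x ->
          forall t0 t1, 0 <= t0 -> t0 <= t1 -> (t1%:E < T)%E ->
            ((S (history x t1) - S (history x t0))%:E
              <= \int[mu]_(r in `[t0, t1]) (s (h (x r)) (u r))%:E)%E].

(** The storage candidate S_1(x(t)) + sum_i int_(t - tau_i)^t Theta_i(x(s)) ds,
    as a function of [phi = x_t]. *)
Definition delay_storage (S1 : 'cV[R]_n -> R)
    (Theta : 'I_q.+1 -> 'cV[R]_n -> R) (phi : R -> 'cV[R]_n) : R :=
  S1 (phi 0)
  + \sum_(i < q.+1) Rintegral mu `[- tau i, 0] (fun r => Theta i (phi r)).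

End delay_systems.

Section quadratic_supply.
Variables (R : realType) (m : nat).

Definition quadratic_supply (S11 S12 S22 : 'M[R]_m) (y u : 'cV[R]_m) : R :=
  ((col_mx y u)^T *m block_mx S11 S12 S12^T S22 *m col_mx y u) 0 0.

End quadratic_supply.

Section dissipation_matrix.
Variables (R : realType) (n m q : nat).
Variables (f : 'M[R]_(n, 1 + q.+1) -> 'cV[R]_n) (g : 'cV[R]_n -> 'M[R]_(n, m)).
Variables (h : 'cV[R]_n -> 'cV[R]_m) (S11 S12 S22 : 'M[R]_m).
Variables (S1 : 'cV[R]_n -> R) (Theta : 'I_q.+1 -> 'cV[R]_n -> R).

(** [x0] is the current state, the columns of [X] are the delayed ones. *)
Definition Psi_xx (x0 : 'cV[R]_n) (X : 'M[R]_(n, q.+1)) : 'M[R]_1 :=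
  (gradient S1 x0)^T *m f (row_mx x0 X)
  + (\sum_(i < q.+1) Theta i x0)%:M
  - (\sum_(i < q.+1) Theta i (col i X))%:M
  - (h x0)^T *m S11 *m h x0.

Definition Psi_xu (x0 : 'cV[R]_n) : 'M[R]_(1, m) :=
  2^-1 *: ((gradient S1 x0)^T *m g x0) - (h x0)^T *m S12.

Definition Psi_uu : 'M[R]_m := - S22.

Definition dissipation_mx (x0 : 'cV[R]_n) (X : 'M[R]_(n, q.+1)) :
    'M[R]_(1 + m) :=
  block_mx (Psi_xx x0 X) (Psi_xu x0) (Psi_xu x0)^T Psi_uu.

End dissipation_matrix.

(* Main.v *)
(** Along a solution, S_1(x(t)) is absolutely continuous, since S_1 is locally
    Lipschitz, so it is the integral of its almost everywhere derivative
    grad S_1(x)^T (f + g u), while the increment over [[t_0, t_1]] of the window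
    integral of Theta_i is int (Theta_i(x(t)) - Theta_i(x(t - tau_i))) dt.
    Evaluating the quadratic form of the dissipation matrix at (1, u(t)) bounds
    the sum of the integrands pointwise by the supply rate.

    The fundamental theorem of calculus for an absolutely continuous F with
    integrable derivative w is obtained by subtracting from F the integral of w:
    this leaves an absolutely continuous H with H' = 0 outside a null set N.  An
    open set U of small measure contains N; a Cousin type argument then goes
    from a to b by finitely many steps, along which H either has small slope or
    moves within U, and absolute continuity controls the latter. *)

Require Import Defs.
From mathcomp Require Import all_boot all_order all_algebra.
From mathcomp Require Import all_classical all_reals all_analysis.
From mathcomp Require Import measurable_realfun ring lra.

Set Implicit Arguments.
Unset Strict Implicit.
Unset Printing Implicit Defensive.

Import Order.TTheory GRing.Theory Num.Theory.
Import numFieldNormedType.Exports.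

Local Open Scope classical_set_scope.
Local Open Scope ring_scope.

(** * Monotonicity of the integral for arbitrary functions *)

Section integral_monotonicity.
Context d (T : measurableType d) (R : realType).
Variable mu : {measure set T -> \bar R}.
Local Open Scope ereal_scope.
Import HBNNSimple.

(** The output map is arbitrary, so that the supply along a trajectory need not
    be measurable; [integral] is then the difference of the lower integrals of
    the positive and the negative parts, and is still monotone. *)
Lemma le_integral_nonmeasurable (D : set T) (f g : T -> \bar R) :
  (forall x, D x -> f x <= g x) ->
  \int[mu]_(x in D) f x <= \int[mu]_(x in D) g x.
Proof.
have ge0_case f1 f2 : (forall x, 0 <= f1 x) ->
    (forall x, D x -> f1 x <= f2 x) ->
    \int[mu]_(x in D) f1 x <= \int[mu]_(x in D) f2 x.
  move=> f10 f12; rewrite (integral_mkcond D) [leRHS]integral_mkcond.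
  rewrite !ge0_integralTE.
  - apply: ereal_sup_le => _ [k kf1 <-]; exists k => // x.
    apply: (le_trans (kf1 x)).
    by rewrite /patch; case: ifPn => // /[!inE]; exact: f12.
  - move=> x; rewrite /patch; case: ifPn => // /[!inE] Dx.
    exact: (le_trans (f10 x) (f12 x Dx)).
  - by move=> x; rewrite /patch; case: ifPn.
move=> fg; rewrite integralE [leRHS]integralE; apply: leeB.
  apply: ge0_case => // x /fg fgx.
  by rewrite !funeposE ge_max !le_max fgx/= lexx orbT.
apply: ge0_case => // x /fg fgx.
by rewrite !funenegE ge_max !le_max leeN2 fgx/= lexx orbT.
Qed.

End integral_monotonicity.

(** * Absolutely continuous functions *)

Section absolute_continuity.
Variable R : realType.
Local Notation mu := (@lebesgue_measure R).

Lemma abs_continuous_unif (V : normedModType R) (a b : R) (F : R -> V) :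
  abs_continuous a b F -> forall e, 0 < e -> exists2 d : R, 0 < d &
  forall l r, a <= l -> l <= r -> r <= b -> r - l < d -> `|F r - F l| < e.
Proof.
move=> acF e e0; have [d d0 H] := acF e e0; exists d => // l r al lr rb rld.
have := H 1%N (fun=> l) (fun=> r); rewrite !big_ord1; apply => //.
by move=> i j _ _ _; rewrite (ord1 i) (ord1 j).
Qed.

Lemma within_continuousP (V : normedModType R) (A : set R) (F : R -> V) :
  {within A, continuous F} <->
  forall t, A t -> forall e, 0 < e -> exists2 d : R, 0 < d &
    forall s, A s -> `|s - t| < d -> `|F s - F t| < e.
Proof.
split => [/subspace_continuousP cF t At e e0|H].
  have /cvgrPdist_lt/(_ _ e0) := cF t At.
  rewrite /within/= => -[d d0 dF]; exists d => // s As st; rewrite distrC.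
  by apply: dF => //=; rewrite distrC.
apply/subspace_continuousP => t At; apply/cvgrPdist_lt => e e0.
have [d d0 dF] := H t At e e0; exists d => // s /= st As; rewrite distrC.
by apply: dF => //; rewrite distrC.
Qed.

Lemma abs_continuous_within (V : normedModType R) (a b : R) (F : R -> V) :
  abs_continuous a b F -> {within `[a, b], continuous F}.
Proof.
move=> acF; apply/within_continuousP => t /=; rewrite in_itv/= => /andP[at_ tb].
move=> e e0; have [d d0 H] := abs_continuous_unif acF e0.
exists d => // s; rewrite /= in_itv/= => /andP[as_ sb].
have [st|/ltW ts] := leP s t.
  by rewrite ler0_norm ?subr_le0// opprB distrC; exact: H.
by rewrite ger0_norm ?subr_ge0//; exact: H.
Qed.

Lemma abs_continuousS (V : normedModType R) (a b c d : R) (F : R -> V) :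
  a <= c -> d <= b -> abs_continuous a b F -> abs_continuous c d F.
Proof.
move=> ac db acF e /acF[del del0 H]; exists del => // k l r lr.
apply: H => i; have [cl [? rd]] := lr i.
by split; [exact: le_trans cl|split => //; exact: le_trans db].
Qed.

Lemma abs_continuousB (V : normedModType R) (a b : R) (F G : R -> V) :
  abs_continuous a b F -> abs_continuous a b G ->
  abs_continuous a b (fun t => F t - G t).
Proof.
move=> acF acG e e0; have e20 : 0 < e / 2 by rewrite divr_gt0.
have [d1 d10 H1] := acF _ e20; have [d2 d20 H2] := acG _ e20.
exists (Num.min d1 d2) => [|k l r lr tr]; first by rewrite lt_min d10.
rewrite lt_min => /andP[s1 s2].
apply: (@le_lt_trans _ _ (\sum_(i < k) (`|F (r i) - F (l i)|
                                        + `|G (r i) - G (l i)|))).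
  apply: ler_sum => i _; rewrite (_ : _ - _ - _ =
    (F (r i) - F (l i)) - (G (r i) - G (l i))); first exact: ler_normB.
  by rewrite !opprB addrACA [RHS]addrACA; congr (_ + _); rewrite addrC.
by rewrite big_split/= (splitr e) ltrD ?H1 ?H2.
Qed.

Lemma lebesgue_measure_bigsetU_itv k (l r : 'I_k -> R) :
  (forall i, l i <= r i) -> trivIset setT (fun i => `]l i, r i[%classic) ->
  mu (\big[setU/set0]_(i < k) `]l i, r i[%classic) =
  (\sum_(i < k) (r i - l i))%:E.
Proof.
move=> lr tr; have muE i : mu `]l i, r i[%classic = (r i - l i)%:E.
  rewrite lebesgue_measure_itv/= lte_fin; case: ltP => //.
  by rewrite le_eqVlt ltNge lr orbF => /eqP ->; rewrite subrr.
rewrite measure_semi_additive_ord//; last exact: bigsetU_measurable.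
by rewrite -sumEFin; apply: eq_bigr => i _; exact: muE.
Qed.

End absolute_continuity.

(** * Absolutely continuous functions with zero derivative almost everywhere *)

Section constancy.
Variable R : realType.
Local Notation mu := (@lebesgue_measure R).

(** Outer regularity only bounds the measure of [U] minus [N]; since [N] is null, subadditivity
    turns this into a bound on [U]. *)
Lemma lebesgue_null_open_cover (N : set R) (e : R) :
  measurable N -> mu N = 0%E -> 0 < e ->
  exists U : set R, [/\ open U, N `<=` U & (mu U < e%:E)%E].
Proof.
move=> mN N0 e0.
have Nle0 : (mu N <= 0)%E by rewrite N0.
have [|U [oU NU Ue]] := lebesgue_regularity_outer mN _ e0.
  exact: le_lt_trans Nle0 (ltry 0).
exists U; split => //; apply: le_lt_trans Ue.
have mU : measurable U by exact: open_measurable.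
rewrite -[in leLHS](setDUK NU); apply: (le_trans (measureU2 _ _ _)) => //.
  exact: measurableD.
by rewrite -[leRHS]add0e leeD2r.
Qed.

(** The convergence of the difference quotient is multiplied out by [s - t], so that the estimate
    also covers [s = t]. *)
Lemma is_derive_slope (V : normedModType R) (F : R -> V) (t : R) (dF : V) :
  is_derive t 1 F dF -> forall e, 0 < e -> exists2 d : R, 0 < d &
  forall s, `|s - t| < d -> `|F s - F t - (s - t) *: dF| <= e * `|s - t|.
Proof.
move=> [cF Ft] e e0.
have : h^-1 *: ((F \o shift t) (h *: 1) - F t) @[h --> 0^'] --> dF.
  by rewrite -Ft; exact: cF.
move=> /cvgrPdist_le/(_ _ e0)[d d0 dFd]; exists d => // s st.
have [->|sNt] := eqVneq s t.
  by rewrite !subrr scale0r subr0 !normr0 mulr0.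
have st0 : s - t != 0 by rewrite subr_eq0.
have := dFd (s - t); rewrite /ball_/= sub0r normrN => /(_ st st0).
rewrite [(s - t) *: 1]mulr1 subrK distrC => sl.
rewrite -ler_pdivrMr ?normr_gt0// mulrC -normfV -normrZ scalerBr scalerA.
by rewrite mulVf// scale1r.
Qed.

Section covering.
Variables (a b : R) (H : R -> R) (U : set R) (e : R).
Hypothesis e_ge0 : 0 <= e.

(* [t] is reached from [a] by finitely many consecutive steps, each of which
   either has slope at most [e] or takes place inside [U]. *)
Let reached (t : R) := exists k (l r : nat -> R),
  [/\ forall i, (i < k)%N -> [/\ a <= l i, l i <= r i, r i <= t
        & `]l i, r i[ `<=` U],
      forall i j, (i < j < k)%N -> r i <= l j &
      `|H t - H a| <= e * (t - a) + \sum_(i < k) `|H (r i) - H (l i)|].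

Let reached_slope s t : reached s -> s <= t ->
  `|H t - H s| <= e * (t - s) -> reached t.
Proof.
move=> [k [l [r [lr sep Hs]]]] st Hst; exists k, l, r; split => //.
  by move=> i /lr[? ? rs ?]; split => //; exact: le_trans st.
rewrite (_ : H t - H a = (H t - H s) + (H s - H a)); last by ring.
apply: (le_trans (ler_normD _ _)); apply: (le_trans (lerD Hst Hs)).
by rewrite addrA -mulrDr addrA subrK.
Qed.

Let reached_open s t : a <= s -> reached s -> s <= t -> `]s, t[ `<=` U ->
  reached t.
Proof.
move=> as_ [k [l [r [lr sep Hs]]]] st stU.
pose l' i := if (i < k)%N then l i else s.
pose r' i := if (i < k)%N then r i else t.
exists k.+1, l', r'; split.
- move=> i; rewrite ltnS /l' /r' => ik; case: ifPn => [/lr[? ? rs ?]|_].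
    by split => //; exact: le_trans st.
  by split.
- move=> i j /andP[ij]; rewrite ltnS => jk.
  rewrite /l' /r' (leq_trans ij jk); case: ifPn => [jk'|_].
    by apply: sep; rewrite ij.
  by have [] := lr i (leq_trans ij jk).
- rewrite big_ord_recr/= /l' /r' ltnn.
  under eq_bigr do rewrite ltn_ord.
  rewrite (_ : H t - H a = (H s - H a) + (H t - H s)); last by ring.
  apply: (le_trans (ler_normD _ _)); rewrite addrA lerD2r.
  by apply: (le_trans Hs); rewrite lerD2r ler_wpM2l// lerD2r.
Qed.

(** A supremum argument replaces the choice of a fine partition: the supremum [c] of the reached
    points is itself reached, and if it were below [b] the gauge at [c] would allow one more step
    beyond it. *)
Lemma slope_open_covering : a <= b ->
  (forall t, a <= t <= b -> exists2 d : R, 0 < d &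
    ((forall s, a <= s <= b -> `|s - t| < d -> `|H s - H t| <= e * `|s - t|)
     \/ ball t d `<=` U)) ->
  exists k (l r : nat -> R),
  [/\ forall i, (i < k)%N -> [/\ a <= l i, l i <= r i, r i <= b
        & `]l i, r i[ `<=` U],
      forall i j, (i < j < k)%N -> r i <= l j &
      `|H b - H a| <= e * (b - a) + \sum_(i < k) `|H (r i) - H (l i)|].
Proof.
move=> ab gauge; pose A := [set t | a <= t <= b /\ reached t].
have Aa : A a.
  split; first by rewrite lexx ab.
  exists 0%N, (fun=> a), (fun=> a); split => //.
  by rewrite big_ord0 !subrr normr0 mulr0 addr0.
have supA : has_sup A by split; [exists a|exists b => t [/andP[]]].
pose c := sup A.
have ac : a <= c by exact: ub_le_sup supA.2 _ Aa.
have cb : c <= b by apply: ge_sup => [|t [/andP[]//]]; exists a.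
have [d d0 gc] := gauge c (introT andP (conj ac cb)).
(* The gauge at [c] covers any short step with [c] as an endpoint; it serves both to arrive at [c]
   from the left and to leave [c] to the right. *)
have step s t : a <= s -> s <= t -> t <= b -> reached s ->
    s = c \/ t = c -> t - s < d -> reached t.
  move=> as_ st tb rs stc tsd; have bt : a <= t by exact: le_trans st.
  have sb : s <= b by exact: le_trans tb.
  case: gc => [slope|ballU].
    apply: (reached_slope rs st); case: stc => <- in slope *.
      by have := slope t; rewrite bt tb ger0_norm ?subr_ge0//; apply.
    rewrite distrC.
    by have := slope s; rewrite as_ sb ler0_norm ?subr_le0// opprB; apply.
  apply: (reached_open as_ rs st) => u /=; rewrite in_itv/= => /andP[su ut].
  apply: ballU; rewrite /ball/=; case: stc => <-.
    by rewrite ltr0_norm ?subr_lt0//; lra.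
  by rewrite gtr0_norm ?subr_gt0//; lra.
have rc : reached c.
  have [s [/andP[as_ sb] rs] cds] := sup_adherent d0 supA.
  have sc : s <= c by apply: (ub_le_sup supA.2); split => //; rewrite as_ sb.
  apply: (step s c) => //; [by right|].
  by rewrite -/c in cds; lra.
suff -> : b = c by [].
apply/eqP; rewrite eq_le cb andbT leNgt; apply/negP => cltb.
(* Halving [d] keeps the step strictly shorter than the gauge, and the minimum keeps it inside
   [[a, b]]. *)
pose t := Num.min b (c + d / 2).
have ct : c < t by rewrite lt_min cltb/= ltrDl divr_gt0.
have tb : t <= b by rewrite ge_min lexx.
have : t <= c.
  apply: (ub_le_sup supA.2); split; first by rewrite tb (le_trans ac (ltW ct)).
  apply: (step c t) => //; [exact: ltW|by left|].
  have : t <= c + d / 2 by rewrite ge_min lexx orbT.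
  by lra.
by rewrite leNgt ct.
Qed.

End covering.

(** The covering bounds the increment of [H] by [e' * (b - a)] from the steps of small slope, plus
    the variation over disjoint intervals inside an open set of measure below [d], which absolute
    continuity bounds by [e']. *)
Lemma abs_continuous_derive0_eq (a b : R) (H : R -> R) : a <= b ->
  abs_continuous a b H ->
  {ae mu, forall t, a < t < b -> is_derive t 1 H 0} ->
  H b = H a.
Proof.
move=> ab acH [N [mN N0 subN]].
apply/eqP; rewrite -subr_eq0 -normr_le0; apply/ler_addgt0Pl => e e0.
(* Chosen so that [e' * (b - a) + e' = e]; the added 1 pays for the steps inside [U] and keeps the
   denominator positive when [a = b]. *)
rewrite addr0; pose e' := e / (b - a + 1).
have ba1 : 0 < b - a + 1 by lra.
have e'0 : 0 < e' by rewrite divr_gt0.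
have [d d0 acd] := acH _ e'0.
(* The derivative is known only in the open interval, so the endpoints join the exceptional set and
   are covered by [U] as well. *)
pose N' := N `|` [set a; b].
have mab : measurable [set a; b] by apply: measurableU; exact: measurable_set1.
have Nle0 : (mu N <= 0)%E by have := lexx (0 : \bar R)%E; rewrite -{1}N0.
have N'0 : mu N' = 0%E.
  apply/eqP; rewrite eq_le measure_ge0 andbT.
  apply: (le_trans (measureU2 _ _ _)) => //; rewrite -[leRHS]adde0 leeD//.
  apply: (le_trans (measureU2 _ _ _)); try exact: measurable_set1.
  have set1le0 (x : R) : (mu [set x] <= 0)%E by rewrite lebesgue_measure_set1.
  by rewrite -[leRHS]adde0 leeD// set1le0.
have mN' : measurable N' by exact: measurableU.
have [U [oU N'U Ud]] := lebesgue_null_open_cover mN' N'0 d0.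
have := @slope_open_covering a b H U e' (ltW e'0) ab.
case=> [t /andP[at_ tb]|k [l [r [lr sep Hab]]]].
  have [tN'|tN'] := pselect (N' t).
    have /nbhs_ballP[g g0 gU] : nbhs t U.
      by apply: open_nbhs_nbhs; split => //; exact: N'U.
    by exists g => //; right.
  have tab : a < t < b.
    by rewrite !lt_neqAle at_ tb !andbT; apply/andP; split; apply/eqP => tE;
      apply: tN'; right; [left|right].
  have dH : is_derive t 1 H 0.
    by apply: contrapT => nH; apply: tN'; left; apply: subN => /= /(_ tab).
  have [g g0 gH] := is_derive_slope dH e'0; exists g => //; left => s _ /gH.
  by rewrite scaler0 subr0.
apply: (le_trans Hab).
have trI : trivIset setT (fun i : 'I_k => `]l i, r i[%classic).
  move=> i j _ _ [x []]; rewrite /= !in_itv/= => /andP[lix xri] /andP[ljx xrj].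
  apply/val_inj => /=; case: (ltngtP i j) => // ij.
    by have := sep i j; rewrite ij ltn_ord leNgt (lt_trans ljx xri) => /(_ isT).
  by have := sep j i; rewrite ij ltn_ord leNgt (lt_trans lix xrj) => /(_ isT).
have lrk (i : 'I_k) : l i <= r i by have [] := lr i (ltn_ord i).
(* The intervals are disjoint and lie in [U], so their total length is at most the measure of
   [U]. *)
have sumd : \sum_(i < k) (r i - l i) < d.
  rewrite -lte_fin -(@lebesgue_measure_bigsetU_itv _ _
    (fun i : 'I_k => l i) (fun i : 'I_k => r i))//.
  apply: le_lt_trans Ud; apply: le_measure; rewrite ?inE.
  - by apply: bigsetU_measurable.
  - exact: open_measurable.
  - apply: (big_ind (fun A => A `<=` U)) => [//|A B AU BU|i _].
      by rewrite subUset.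
    by have [] := lr i (ltn_ord i).
have /ltW : \sum_(i < k) `|H (r i) - H (l i)| < e'.
  apply: (acd k (fun i : 'I_k => l i) (fun i : 'I_k => r i)) => // i.
  by have [] := lr i (ltn_ord i).
rewrite (_ : e = e' * (b - a) + e'); first by rewrite lerD2l.
by rewrite /e'; field; lra.
Qed.

End constancy.

(** * The fundamental theorem of calculus for absolutely continuous functions *)

Section fundamental_theorem.
Variable R : realType.
Local Notation mu := (@lebesgue_measure R).

(** The integral of [|f|] over a set of small measure is small; this is applied to the union of the
    disjoint intervals, over which the integral splits into a sum. *)
Lemma abs_continuous_integral (a b : R) (f : R -> R) :
  mu.-integrable setT (EFin \o f) ->
  abs_continuous a b (fun t => \int[mu]_(s in `]-oo, t]) f s).
Proof.
move=> intf e e0; have [d [d0 fd]] := integral_normr_continuous intf e0.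
exists d => // k l r lr tr lrd.
have {}lr i : l i <= r i by have [_ []] := lr i.
have intfS A : measurable A -> mu.-integrable A (EFin \o f).
  by move=> mA; apply: integrableS intf.
have intnfS A : measurable A -> mu.-integrable A (EFin \o (fun x => `|f x|)).
  by move=> /intfS; exact: integrable_norm.
have mD : measurable (\big[setU/set0]_(i < k) `]l i, r i[%classic).
  by apply: bigsetU_measurable.
have /(fd _ mD) : (mu (\big[setU/set0]_(i < k) `]l i, r i[%classic) < d%:E)%E.
  by rewrite lebesgue_measure_bigsetU_itv// lte_fin.
apply: le_lt_trans; rewrite -lee_fin [leRHS]fineK; last first.
  by apply: integrable_fin_num => //; exact: intnfS.
rewrite integral_bigsetU_EFin//=; last 3 first.
- exact: index_enum_uniq.
- by apply: sub_trivIset tr.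
- exact: measurable_int (intnfS _ mD).
rewrite -sumEFin; apply: lee_sum => i _.
rewrite Rintegral_itvB ?bnd_simp//; last exact: intfS.
rewrite -Rintegral_itv_bndo_bndc; last exact: intfS.
apply: (@le_trans _ _ (\int[mu]_(x in `]l i, r i[) `|f x|)%:E).
  by rewrite lee_fin; apply: le_normr_Rintegral => //; exact: intfS.
by rewrite fineK//; apply: integrable_fin_num => //; exact: intnfS.
Qed.

Lemma FTC_abs_continuous (a b : R) (F f : R -> R) : a <= b ->
  abs_continuous a b F -> mu.-integrable `[a, b] (EFin \o f) ->
  {ae mu, forall t, a < t < b -> is_derive t 1 F (f t)} ->
  (\int[mu]_(t in `[a, b]) (f t)%:E = (F b - F a)%:E)%E.
Proof.
(* Extension by zero makes [g] integrable on the whole line, so that its primitive from minus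
   infinity is differentiable almost everywhere with derivative [g], while the integral over
   [[a, b]] is unchanged. *)
move=> ab acF intf dF; pose g : R -> R := f \_ `[a, b].
have intg : mu.-integrable setT (EFin \o g).
  by move: intf; rewrite integrable_mkcond//= (restrict_EFin f).
pose G (t : R) : R := \int[mu]_(s in `]-oo, t]) g s.
have dG : {ae mu, forall t : R, is_derive t (1 : R) G (g t : R)}.
  have intgS y : mu.-integrable `]-oo, y] (EFin \o g).
    exact: integrableS intg.
  have locg : locally_integrable [set: R] g.
    by apply: open_integrable_locally => //; exact: openT.
  move: (FTC1Ny intgS locg); apply: filterS.
    exact: (ae_filter_ringOfSetsType mu).
  move=> t [dGt Gt].
  by rewrite -Gt derive1E; exact: derivableP.
have acG : abs_continuous a b G by exact: abs_continuous_integral.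
have : F b - G b = F a - G a.
  apply: (@abs_continuous_derive0_eq _ a b (fun t => F t - G t)) => //.
    exact: abs_continuousB.
  move: dF dG; apply: filterS2; first exact: (ae_filter_ringOfSetsType mu).
  move=> t dFt dGt tab.
  have gt : g t = f t.
    by rewrite /g patchE mem_set//= in_itv/=; case/andP: tab => /ltW -> /ltW ->.
  by rewrite -(subrr (f t)) -[X in _ - X]gt; apply: is_deriveB; exact: dFt.
move=> FG; have -> : F b - F a = G b - G a by lra.
rewrite /G Rintegral_itvB ?bnd_simp//; last exact: integrableS intg.
rewrite Rintegral_itv_obnd_cbnd; last exact: integrableS intg.
rewrite fineK; last by apply: integrable_fin_num => //; exact: integrableS intg.
by apply: eq_integral => t tab; rewrite /g patchE tab.
Qed.

(** By compactness of [[a, b]], the local Lipschitz constants of [Phi] along the curve [F] are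
    replaced by one constant valid for all pairs of sufficiently close times. *)
Lemma abs_continuous_comp (V W : normedModType R) (a b : R) (F : R -> V)
    (Phi : V -> W) :
  abs_continuous a b F -> locally_lipschitz Phi ->
  abs_continuous a b (Phi \o F).
Proof.
move=> acF lipPhi.
have cF := abs_continuous_within acF.
(* The single parameter [e] is both the radius in time and the inverse of the Lipschitz constant, so
   both conditions relax as [e] decreases to 0 and one filter suffices for the compactness
   argument. *)
pose P (e t : R) := forall l r, a <= l <= b -> a <= r <= b ->
  `|l - t| < e -> `|r - t| < e ->
  `|Phi (F r) - Phi (F l)| <= e^-1 * `|F r - F l|.
have nearP : \forall e \near 0^'+, `[a, b]%classic `<=` P e /\ 0 < e.
  apply: filterI; last exact: nbhs_right_gt.
  have ncov : near_covering_within `[a, b]%classic.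
    apply/near_covering_withinP/compact_near_coveringP.
    exact: segment_compact.
  apply: (ncov R (0^'+) P) => t tab.
  have [U /nbhs_ballP[rho rho0 rhoU] lipU] := lipPhi (F t).
  have [M M0 lipM] : exists2 M, 0 < M & forall v w, U v -> U w ->
      `|Phi v - Phi w| <= M * `|v - w|.
    have [M [M0 MU]] := pinfty_ex_gt0 lipU; exists M => // v w Uv Uw.
    exact: (MU (v, w)).
  have [d d0 dF] := (within_continuousP _ _).1 cF t tab _ rho0.
  have d20 : 0 < d / 2 by rewrite divr_gt0.
  near=> s e => sab l r lab rab ls rs.
  have e_gt0 : 0 < e by near: e; exact: nbhs_right_gt.
  (* With [s] within [d / 2] of [t] and [e < d / 2], times within [e] of [s] are within [d] of [t],
     where [F] stays in the Lipschitz neighborhood [U]. *)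
  have st : `|s - t| < d / 2.
    by rewrite distrC; near: s; exact: nbhsx_ballx.
  have eM : e <= M^-1.
    by near: e; apply: nbhs_right_ltW; rewrite invr_gt0.
  have ed : e < d / 2 by near: e; exact: nbhs_right_lt.
  have inU u : a <= u <= b -> `|u - s| < e -> U (F u).
    move=> uab us; apply: rhoU; rewrite -ball_normE/= distrC; apply: dF => //.
    by rewrite -(subrKA s) (le_lt_trans (ler_normD _ _))//; lra.
  apply: (le_trans (lipM _ _ (inU _ rab rs) (inU _ lab ls))).
  rewrite ler_wpM2r// -[M]invrK lef_pV2 ?posrE ?invr_gt0//.
near (0:R)^'+ => e0.
have [e0P e0_gt0] : `[a, b]%classic `<=` P e0 /\ 0 < e0 by near: e0.
move=> e e_gt0; have [d d_gt0 acd] := acF _ (mulr_gt0 e_gt0 e0_gt0).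
(* A total length below [e0] makes each single interval shorter than [e0], so [P e0] applies with
   the left endpoint as centre. *)
exists (Num.min e0 d) => [|k l r lr tr]; first by rewrite lt_min e0_gt0.
rewrite lt_min => /andP[se0 sd].
apply: (@le_lt_trans _ _ (e0^-1 * \sum_(i < k) `|F (r i) - F (l i)|)).
  rewrite mulr_sumr; apply: ler_sum => i _; have [al [lri rb]] := lr i.
  have lab : a <= l i <= b by rewrite al (le_trans lri).
  apply: (e0P (l i)) => //; first by rewrite (le_trans al).
    by rewrite subrr normr0.
  rewrite ger0_norm ?subr_ge0//; apply: le_lt_trans se0.
  rewrite (bigD1 i)//= lerDl sumr_ge0// => j _.
  by rewrite subr_ge0; have [_ []] := lr j.
by rewrite mulrC ltr_pdivrMr// acd.
Unshelve. all: by end_near. Qed.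

End fundamental_theorem.

(** * Continuously differentiable functions *)

Section continuously_differentiable.
Variables (R : realType) (n : nat).
Implicit Types F : 'cV[R]_n -> R.

Lemma ler_norm_mx_entry m k (A : 'M[R]_(m, k)) i j : `|A i j| <= `|A|.
Proof.
rewrite [leRHS]mx_normrE.
exact: (le_bigmax _ (fun p => `|A p.1 p.2|) (i, j)).
Qed.

(** The norm of a column is the maximum of its entries in absolute value, hence the factor [n]. *)
Lemma ler_norm_dotmx (v w : 'cV[R]_n) :
  `|(v^T *m w) 0 0| <= n%:R * `|v| * `|w|.
Proof.
rewrite mxE; apply: (le_trans (ler_norm_sum _ _ _)).
have -> : n%:R * `|v| * `|w| = \sum_(i < n) `|v| * `|w|.
  by rewrite sumr_const card_ord -mulrA mulr_natl.
apply: ler_sum => i _.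
by rewrite normrM mxE ler_pM ?ler_norm_mx_entry.
Qed.

Lemma diff_gradient F (x v : 'cV[R]_n) : differentiable F x ->
  'd F x v = ((gradient F x)^T *m v) 0 0.
Proof.
move=> dF; rewrite [in LHS](matrix_sum_delta v) mxE linear_sum/=.
apply: eq_bigr => i _; rewrite big_ord1 linearZ/= !mxE deriveE// mulrC.
by [].
Qed.

Lemma is_derive_comp_gradient F (x : R -> 'cV[R]_n) (t : R) (dx : 'cV[R]_n) :
  differentiable F (x t) -> is_derive t 1 x dx ->
  is_derive t 1 (F \o x) (((gradient F (x t))^T *m dx) 0 0).
Proof.
move=> dF [/derivable1_diffP dX Dx].
have dFx : differentiable (F \o x) t by exact: differentiable_comp.
split; first exact/derivable1_diffP.
have {}Dx : 'd x t 1 = dx by rewrite -deriveE.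
by rewrite deriveE// diff_comp//= Dx diff_gradient.
Qed.

(** On a ball where the gradient differs from its value at [x0] by less than 1, the mean value
    theorem along the segment joining two points gives the constant; the segment stays in the ball
    by convexity. *)
Lemma C1_locally_lipschitz F : continuously_differentiable F ->
  locally_lipschitz F.
Proof.
move=> [dF cF] x0.
have /cvgrPdist_lt/(_ _ ltr01)/nbhs_ballP[rho rho0 gradF] := cF x0.
exists (ball x0 rho); first exact: nbhsx_ballx.
have pf : ProperFilter (globally (ball x0 rho `*` ball x0 rho)).
  by apply: (globally_properfilter (a := (x0, x0))); split; exact: ballxx.
apply: (@klipschitzW _ _ _ (n%:R * (`|gradient F x0| + 1))) => -[y z] [By Bz].
rewrite /= in By Bz *; pose p (s : R) := z + s *: (y - z).
have Bp s : 0 <= s <= 1 -> ball x0 rho (p s).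
  move=> /andP[s0 s1]; move: By Bz; rewrite -!ball_normE/= => By Bz.
  have -> : x0 - p s = (1 - s) *: (x0 - z) + s *: (x0 - y).
    by apply/colP => i; rewrite /p !mxE; ring.
  apply: (le_lt_trans (ler_normD _ _)); rewrite !normrZ.
  rewrite ger0_norm ?subr_ge0// (ger0_norm s0).
  (* For positive [s] the strict bound on the term in [y] makes the convex combination strict; at
     [s = 0] it comes from the term in [z]. *)
  have [->|sNe0] := eqVneq s 0; first by rewrite mul0r addr0 subr0 mul1r.
  have {}s0 : 0 < s by rewrite lt_def sNe0.
  by nra.
have dp (s : R) : is_derive s 1 p (y - z).
  have cvp : h^-1 *: ((p \o shift s) (h *: 1) - p s) @[h --> 0^'] --> y - z.
    apply: cvg_near_cst; near=> h.
    have h0 : h != 0 by near: h; exact: nbhs_dnbhs_neq.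
    rewrite /p/= [h *: 1]mulr1 scalerDl addrCA addrK scalerA mulVf//.
    by rewrite scale1r.
  by split; [exact: cvgP cvp|exact: cvg_lim].
have dFp (s : R) :
    is_derive s 1 (F \o p) (((gradient F (p s))^T *m (y - z)) 0 0).
  exact: is_derive_comp_gradient.
have [|c c01] := @MVT R (F \o p) _ 0 1 ltr01 (fun s _ => dFp s).
  apply: continuous_subspaceT => s; apply: differentiable_continuous.
  by apply/derivable1_diffP; case: (dFp s).
rewrite /p /= scale0r scale1r addr0 subr0 mulr1 subrKC => ->.
apply: (le_trans (ler_norm_dotmx _ _)); rewrite ler_wpM2r// ler_wpM2l//.
have : `|gradient F x0 - gradient F (p c)| < 1.
  by apply: gradF; apply: Bp; rewrite !ltW ?(itvP c01).
have := ler_normB (gradient F x0) (gradient F x0 - gradient F (p c)).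
by rewrite subKr; lra.
Unshelve. all: by end_near. Qed.

End continuously_differentiable.

(** * Integrals over sliding windows *)

Section windows.
Variable R : realType.
Local Notation mu := (@lebesgue_measure R).
Implicit Types (k : R -> R) (a b c : R).

Lemma within_continuous_shift (V : normedModType R) (k : R -> V) a b c :
  {within `[a + c, b + c], continuous k} ->
  {within `[a, b], continuous (fun s => k (s + c))}.
Proof.
move=> /within_continuousP ck; apply/within_continuousP => t tab e e0.
have shab s : s \in `[a, b] -> (s + c) \in `[a + c, b + c].
  by rewrite !in_itv/= !lerD2r.
have [d d0 kd] := ck (t + c) (shab t tab) e e0; exists d => // s sab st.
by apply: kd; [exact: shab|rewrite opprD addrACA subrr addr0].
Qed.

Lemma Rintegral_shift k a b c : a <= b ->
  {within `[a + c, b + c], continuous k} ->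
  \int[mu]_(s in `[a, b]) k (s + c) = \int[mu]_(s in `[a + c, b + c]) k s.
Proof.
move=> ab ck; rewrite /Rintegral; congr fine.
have d1 : (shift c)^`()%classic = cst 1 :> (R -> R).
  apply/funext => t; rewrite derive1E.
  by have [_] := is_derive_shift t (1 : R) c.
rewrite (@integration_by_substitution_increasing _ (shift c) k)//; last 5 first.
- by move=> s t _ _ st; rewrite /= ltrD2r.
- by rewrite d1 => t _; exact: cvg_cst.
- by rewrite d1; exact: is_cvg_cst.
- by rewrite d1; exact: is_cvg_cst.
- split.
  + by move=> t _; have [] := is_derive_shift t (1 : R) c.
  + by apply: cvgD; [apply: cvg_at_right_filter; exact: cvg_id|exact: cvg_cst].
  + by apply: cvgD; [apply: cvg_at_left_filter; exact: cvg_id|exact: cvg_cst].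
by apply: eq_integral => t _; rewrite d1 /= mulr1.
Qed.

Lemma within_continuous_integrable k a b :
  {within `[a, b], continuous k} -> mu.-integrable `[a, b] (EFin \o k).
Proof.
move=> ck; apply: continuous_compact_integrable => //; exact: segment_compact.
Qed.

Lemma within_continuous_subitv (V : normedModType R) (k : R -> V) a b c d :
  a <= c -> d <= b -> {within `[a, b], continuous k} ->
  {within `[c, d], continuous k}.
Proof.
move=> ac db; apply: continuous_subspaceW => t /=.
rewrite !in_itv/= => /andP[ct td].
by rewrite (le_trans ac)// (le_trans td).
Qed.

Lemma within_continuous_glue (V : normedModType R) (F : R -> V) (a b c : R) :
  a <= c -> c <= b -> {within `[a, c], continuous F} ->
  {within `[c, b], continuous F} -> {within `[a, b], continuous F}.
Proof.
move=> ac cb cac ccb; rewrite (_ : `[a, b]%classic = `[a, c] `|` `[c, b]).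
  by apply: withinU_continuous => //; exact: interval_closed.
apply/seteqP; split => t /=; rewrite !in_itv/=.
  by move=> /andP[-> ->]; rewrite andbT; apply/orP; exact: le_total.
by move=> [] /andP[at_ tb]; rewrite ?at_ ?tb ?(le_trans ac)// (le_trans tb).
Qed.

Lemma Rintegral_split k a b c : a <= c -> c <= b ->
  {within `[a, b], continuous k} ->
  \int[mu]_(s in `[a, b]) k s =
  \int[mu]_(s in `[a, c]) k s + \int[mu]_(s in `[c, b]) k s.
Proof.
move=> ac cb ck; have ik := within_continuous_integrable ck.
apply/eqP; rewrite addrC -subr_eq Rintegral_itvB ?bnd_simp//.
rewrite Rintegral_itv_obnd_cbnd//; apply: integrableS ik => //.
by apply: subset_itvr; rewrite bnd_simp.
Qed.

(** After shifting, the windows are [[b - c, b]] and [[a - c, a]]. Splitting the integral over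
    [[a - c, b]] once at [a] and once at [b - c] gives the identity, whether or not the windows
    overlap. *)
Lemma Rintegral_window k a b c : 0 <= c -> a <= b ->
  {within `[a - c, b], continuous k} ->
  \int[mu]_(s in `[- c, 0]) k (b + s) - \int[mu]_(s in `[- c, 0]) k (a + s) =
  \int[mu]_(t in `[a, b]) (k t - k (t - c)).
Proof.
move=> c0 ab ck.
have cS u v : a - c <= u -> v <= b -> {within `[u, v], continuous k}.
  by move=> au vb; exact: within_continuous_subitv ck.
have wE t : a <= t -> t <= b ->
    \int[mu]_(s in `[- c, 0]) k (t + s) = \int[mu]_(s in `[t - c, t]) k s.
  move=> at_ tb; under eq_Rintegral do rewrite addrC.
  by rewrite Rintegral_shift ?oppr_le0 ?add0r 1?addrC//; apply: cS => //; lra.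
rewrite !wE//.
rewrite RintegralB//; last 2 first.
- by apply: within_continuous_integrable; apply: cS => //; lra.
- by apply: within_continuous_integrable; apply: within_continuous_shift;
     apply: cS => //; lra.
rewrite Rintegral_shift//; last by apply: cS; lra.
have aca : a - c <= a by lra.
have acbc : a - c <= b - c by lra.
have bcb : b - c <= b by lra.
have := Rintegral_split aca ab ck; rewrite (Rintegral_split acbc bcb ck).
lra.
Qed.

(** A continuous factor is measurable and bounded on a compact interval, so the product stays
    integrable. *)
Lemma integrable_continuousM (k v : R -> R) a b :
  {within `[a, b], continuous k} -> mu.-integrable `[a, b] (EFin \o v) ->
  mu.-integrable `[a, b] (EFin \o (fun t => k t * v t)).
Proof.
move=> ck iv; rewrite (_ : _ \o _ = ((EFin \o k) \* (EFin \o v))%E)//.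
apply: integrableMr => //.
  apply/measurable_EFinP.
  exact: (measurable_int _ (within_continuous_integrable ck)).
have /compact_bounded[M [_ kM]] :=
  continuous_compact ck (@segment_compact _ a b).
exists M; split; rewrite ?num_real // => x Mx t tab.
by apply: (kM x Mx); exists t.
Qed.

End windows.

(** * Continuity of locally Lipschitz maps and of matrix-valued functions *)

Section continuity.
Variable R : realType.

Lemma locally_lipschitz_continuous (V W : normedModType R) (F : V -> W) :
  locally_lipschitz F -> continuous F.
Proof.
move=> lipF x; have [U Ux lipU] := lipF x.
have [M [M0 FM]] := pinfty_ex_gt0 lipU.
apply/cvgrPdist_lt => e e0; have eM0 : 0 < e / M by rewrite divr_gt0.
have /cvgrPdist_lt/(_ _ eM0) xe : y @[y --> x] --> x by exact: cvg_id.
near=> y.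
have Uy : U y by near: y.
have /= := FM (x, y) (conj (nbhs_singleton Ux) Uy).
by move=> /le_lt_trans; apply; rewrite mulrC -ltr_pdivlMr//; near: y.
Unshelve. all: by end_near. Qed.

Section matrices.
Variables (T : topologicalType) (m n : nat).

(** The domain is an arbitrary topological space, so that it can be instantiated with the subspace
    topology of a time interval. *)
Lemma continuous_mx (M : T -> 'M[R]_(m, n)) :
  (forall i j, continuous (fun t => M t i j)) -> continuous M.
Proof.
move=> cM t; apply/cvgrPdist_le => e e0; near=> s.
rewrite /Num.Def.normr/= mx_normrE (bigmax_le _ (ltW e0))//= => i _.
rewrite !mxE; move: i; near: s; apply: filter_forall => /= i.
by have /cvgrPdist_le := cM i.1 i.2 t; exact.
Unshelve. all: by end_near. Qed.

Lemma continuous_tr_mulmx_entry (G : T -> 'cV[R]_m) (N : T -> 'M[R]_(m, n)) j :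
  continuous G -> continuous N -> continuous (fun t => ((G t)^T *m N t) 0 j).
Proof.
move=> cG cN; rewrite (_ : (fun _ => _) =
    (fun t => \sum_i (G t i 0 * N t i j))); last first.
  by apply/funext => t; rewrite mxE; apply: eq_bigr => i _; rewrite mxE.
apply: continuous_big => [|i _ t]; first exact: add_continuous.
apply: continuousM.
  exact: (continuous_comp (cG t) (@coord_continuous _ _ _ i 0 _)).
exact: (continuous_comp (cN t) (@coord_continuous _ _ _ i j _)).
Qed.

End matrices.

End continuity.

(** * The dissipation inequality *)

Section matrix_inequality.
Variable R : realType.

Lemma block_quadratic_form p m (A : 'M[R]_p) (B : 'M[R]_(p, m)) (C : 'M[R]_m)
    (y : 'cV[R]_p) (u : 'cV[R]_m) :
  ((col_mx y u)^T *m block_mx A B B^T C *m col_mx y u) 0 0 =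
  (y^T *m A *m y) 0 0 + 2 * (y^T *m B *m u) 0 0 + (u^T *m C *m u) 0 0.
Proof.
have BT : (u^T *m B^T *m y) 0 0 = (y^T *m B *m u) 0 0.
  by rewrite -[in LHS](trmxK y) -!trmx_mul mulmxA [LHS]mxE.
have addE (M N : 'M[R]_1) : (M + N) 0 0 = M 0 0 + N 0 0 by rewrite mxE.
by rewrite tr_col_mx mul_row_block mul_row_col !mulmxDl !addE BT; ring.
Qed.

(** In the quadratic form at [(1, u)] the cross term occurs twice, which absorbs the factor 1/2 in
    [Psi_xu]; the terms in [S11], [S12] and [S22] add up to minus the supply rate. *)
Lemma dissipation_mx_supply n m q (f : 'M[R]_(n, 1 + q.+1) -> 'cV[R]_n)
    (g : 'cV[R]_n -> 'M[R]_(n, m)) (h : 'cV[R]_n -> 'cV[R]_m)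
    (S11 S12 S22 : 'M[R]_m) (S1 : 'cV[R]_n -> R)
    (Theta : 'I_q.+1 -> 'cV[R]_n -> R) (x0 : 'cV[R]_n) (X : 'M[R]_(n, q.+1))
    (u : 'cV[R]_m) :
  neg_semidef_mx (dissipation_mx f g h S11 S12 S22 S1 Theta x0 X) ->
  ((gradient S1 x0)^T *m (f (row_mx x0 X) + g x0 *m u)) 0 0
    + \sum_(i < q.+1) (Theta i x0 - Theta i (col i X))
  <= quadratic_supply S11 S12 S22 (h x0) u.
Proof.
move=> /(_ (col_mx 1%:M u)); rewrite /dissipation_mx /quadratic_supply.
rewrite !block_quadratic_form trmx1 !mul1mx mulmx1 sumrB mulmxDr.
have addE (M N : 'M[R]_1) : (M + N) 0 0 = M 0 0 + N 0 0 by rewrite mxE.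
have oppE (M : 'M[R]_1) : (- M) 0 0 = - M 0 0 by rewrite mxE.
have scaleE c (M : 'M[R]_1) : (c *: M) 0 0 = c * M 0 0 by rewrite mxE.
have scalarE (c : R) : (c%:M : 'M[R]_1) 0 0 = c by rewrite mxE eqxx mulr1n.
rewrite /Psi_xx /Psi_xu /Psi_uu mulmxBl -scalemxAl mulmxN mulNmx !mulmxA.
rewrite !(addE, oppE, scaleE, scalarE).
lra.
Qed.

End matrix_inequality.

(** * Increments of the storage function along a solution *)

Section dissipation.
Variables (R : realType) (n m q : nat) (tau : 'I_q.+1 -> R).
Hypothesis tau_gt0 : forall i, 0 < tau i.
Hypothesis tau_mono : forall i j : 'I_q.+1, (i <= j)%N -> tau i <= tau j.
Local Notation mu := (@lebesgue_measure R).
Local Notation maxdelay := (tau ord_max).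

Lemma tau_le_max i : tau i <= maxdelay.
Proof. by apply: tau_mono; exact: leq_ord. Qed.

Lemma delayed_time_ge i t : 0 <= t -> - maxdelay <= t - tau i.
Proof.
by move=> t0; rewrite lerBrDr (le_trans _ t0)// addrC subr_le0 tau_le_max.
Qed.

Variables (f : 'M[R]_(n, 1 + q.+1) -> 'cV[R]_n) (g : 'cV[R]_n -> 'M[R]_(n, m)).
Hypotheses (f_lip : locally_lipschitz f) (g_lip : locally_lipschitz g).
Variables (S1 : 'cV[R]_n -> R) (Theta : 'I_q.+1 -> 'cV[R]_n -> R).
Hypothesis S1_C1 : continuously_differentiable S1.
Hypothesis Theta_cont : forall i, continuous (Theta i).
Variables (phi x : R -> 'cV[R]_n) (u : R -> 'cV[R]_m) (T : \bar R).
Hypothesis phi_C1 : C1_on (- maxdelay) 0 phi.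
Hypothesis u_adm : admissible_input u.
Hypothesis x_sol : solution tau f g phi u T x.
Variables (t0 t1 : R).
Hypotheses (t0_ge0 : 0 <= t0) (t01 : t0 <= t1) (t1T : (t1%:E < T)%E).

(** Up to time 0, included, [x] coincides with the continuous history, and from 0 on it is
    absolutely continuous; the two closed pieces glue at 0. *)
Lemma solution_continuous : {within `[- maxdelay, t1], continuous x}.
Proof.
have [x_phi x_ac _] := x_sol; have [dphi [cphi _ _]] := phi_C1.
have t1_ge0 := le_trans t0_ge0 t01.
apply: (within_continuous_glue (c := 0)) => //.
- by rewrite oppr_le0 ltW.
- move: cphi => /within_continuousP cphi; apply/within_continuousP => t tD e e0.
  have [d d0 dphiP] := cphi t tD e e0; exists d => // s sD st.
  by rewrite !x_phi//; exact: dphiP.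
- by apply: abs_continuous_within; exact: x_ac.
Qed.

Let vel t := f (row_mx (x t) (delayed_states tau x t)) + g (x t) *m u t.
Let dS1 t := ((gradient S1 (x t))^T *m vel t) 0 0.

(** The drift part is continuous in time. The input is only integrable, but it enters linearly, each
    component being multiplied by a continuous coefficient. *)
Lemma storage_derivative_integrable : mu.-integrable `[t0, t1] (EFin \o dS1).
Proof.
have cx : {within `[t0, t1], continuous x}.
  apply: within_continuous_subitv solution_continuous => //.
  by rewrite (le_trans _ t0_ge0)// oppr_le0 ltW.
have cdel : {within `[t0, t1], continuous (delayed_states tau x)}.
  apply: continuous_mx => k i.
  have cxi : {within `[t0, t1], continuous (fun t => x (t - tau i))}.
    apply: within_continuous_shift.
    apply: within_continuous_subitv solution_continuous => //.
      exact: delayed_time_ge.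
    by have := tau_gt0 i; lra.
  rewrite (_ : (fun _ => _) =
      (fun M : 'cV[R]_n => M k 0) \o (fun t => x (t - tau i))).
    by apply: within_continuous_comp cxi => y _; exact: coord_continuous.
  by apply/funext => t; rewrite mxE.
have crow : {within `[t0, t1], continuous
    (fun t => row_mx (x t) (delayed_states tau x t))}.
  apply: continuous_mx => k j.
  rewrite (_ : (fun _ => _) = match fintype.split j with
    | inl i => (fun M : 'cV[R]_n => M k i) \o x
    | inr i => (fun M : 'M[R]_(n, q.+1) => M k i) \o delayed_states tau x
    end); last by apply/funext => t; rewrite mxE; case: fintype.split.
  case: fintype.split => i; last first.
    by apply: within_continuous_comp cdel => y _; exact: coord_continuous.
  by apply: within_continuous_comp cx => y _; exact: coord_continuous.
have cgrad : {within `[t0, t1], continuous (gradient S1 \o x)}.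
  by apply: within_continuous_comp cx => y _; case: S1_C1 => _; exact.
have cf : {within `[t0, t1], continuous
    (fun t => ((gradient S1 (x t))^T
               *m f (row_mx (x t) (delayed_states tau x t))) 0 0)}.
  apply: continuous_tr_mulmx_entry => //.
  apply: within_continuous_comp crow => y _.
  exact: (locally_lipschitz_continuous f_lip).
have cg j : {within `[t0, t1], continuous
    (fun t => ((gradient S1 (x t))^T *m g (x t)) 0 j)}.
  apply: continuous_tr_mulmx_entry => //.
  apply: within_continuous_comp cx => y _.
  exact: (locally_lipschitz_continuous g_lip).
rewrite (_ : EFin \o dS1 = fun t =>
  ((((gradient S1 (x t))^T *m f (row_mx (x t) (delayed_states tau x t))) 0 0)%:E
  + \sum_(j < m) (((gradient S1 (x t))^T *m g (x t)) 0 j * u t j 0)%:E)%E).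
  apply: integrableD => //; first exact: within_continuous_integrable.
  apply: integrable_sum => // j _; apply: integrable_continuousM => //.
  apply: integrableS (u_adm j (le_trans t0_ge0 t01)) => //.
  by apply: subset_itvr; rewrite bnd_simp.
apply/funext => t /=.
by rewrite sumEFin -EFinD /dS1 /vel mulmxDr mulmxA [in LHS]mxE [X in _ + X]mxE.
Qed.

Lemma storage_integral :
  (\int[mu]_(t in `[t0, t1]) (dS1 t)%:E = (S1 (x t1) - S1 (x t0))%:E)%E.
Proof.
have [_ x_ac dx] := x_sol.
apply: (@FTC_abs_continuous _ _ _ (S1 \o x)) => //.
- apply: abs_continuous_comp; last exact: C1_locally_lipschitz.
  apply: (abs_continuousS t0_ge0 (lexx t1)).
  by apply: x_ac => //; exact: le_trans t01.
- exact: storage_derivative_integrable.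
- move: dx; apply: filterS; first exact: (ae_filter_ringOfSetsType mu).
  move=> t dxt /andP[t0t tt1]; apply: is_derive_comp_gradient.
    by case: S1_C1.
  by apply: dxt; [exact: le_lt_trans t0t|apply: lt_trans t1T; rewrite lte_fin].
Qed.

Let window i t := Theta i (x t) - Theta i (x (t - tau i)).

Lemma delay_storage_increment :
  ((delay_storage tau S1 Theta (history x t1)
    - delay_storage tau S1 Theta (history x t0))%:E
  = \int[mu]_(t in `[t0, t1]) (dS1 t + \sum_(i < q.+1) window i t)%:E)%E.
Proof.
(* The window starting at [t0 - tau i] may reach into the initial history, where [x] is still
   continuous. *)
have cTheta i : {within `[t0 - tau i, t1], continuous (Theta i \o x)}.
  apply: (@within_continuous_comp _ _ _ `[t0 - tau i, t1] x (Theta i)).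
    by move=> y _; exact: Theta_cont.
  apply: within_continuous_subitv solution_continuous => //.
  exact: delayed_time_ge.
have iwin i : mu.-integrable `[t0, t1] (EFin \o window i).
  have := tau_gt0 i => taui.
  rewrite (_ : EFin \o _ = ((EFin \o (Theta i \o x))
     \- (EFin \o (fun t => (Theta i \o x) (t - tau i)%R)))%E)//.
  apply: integrableB => //; apply: within_continuous_integrable.
    by apply: within_continuous_subitv (cTheta i) => //; lra.
  apply: within_continuous_shift.
  by apply: within_continuous_subitv (cTheta i) => //; lra.
under eq_integral do rewrite EFinD -sumEFin.
rewrite integralD//; last 2 first.
  exact: storage_derivative_integrable.
  by apply: integrable_sum => // i _; exact: iwin.
rewrite storage_integral integral_sum//.
rewrite /delay_storage /history !addr0 opprD addrACA -sumrB EFinD -sumEFin.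
congr (_ + _)%E; apply: eq_bigr => i _.
rewrite (@Rintegral_window _ (Theta i \o x))//; last exact: ltW.
rewrite /Rintegral fineK//; apply: integrable_fin_num => //; exact: iwin.
Qed.

End dissipation.

Theorem corollary1 (R : realType) (n m q : nat)
  (tau : 'I_q.+1 -> R)
  (tau_gt0 : forall i, 0 < tau i)
  (tau_mono : forall i j : 'I_q.+1, (i <= j)%N -> tau i <= tau j)
  (f : 'M[R]_(n, 1 + q.+1) -> 'cV[R]_n)
  (g : 'cV[R]_n -> 'M[R]_(n, m))
  (h : 'cV[R]_n -> 'cV[R]_m)
  (f_lip : locally_lipschitz f)
  (g_lip : locally_lipschitz g)
  (S11 S12 S22 : 'M[R]_m)
  (S11_sym : S11^T = S11)
  (S22_sym : S22^T = S22)
  (S1 : 'cV[R]_n -> R)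
  (S1_ge0 : forall x, 0 <= S1 x)
  (S1_C1 : continuously_differentiable S1)
  (Theta : 'I_q.+1 -> 'cV[R]_n -> R)
  (Theta_cont : forall i, continuous (Theta i))
  (Theta_psd : forall i, pos_semidef_fun (Theta i))
  (storage0 : delay_storage tau S1 Theta (fun=> 0) = 0)
  (LMI : forall (x0 : 'cV[R]_n) (X : 'M[R]_(n, q.+1)),
    neg_semidef_mx (dissipation_mx f g h S11 S12 S22 S1 Theta x0 X)) :
  dissipative tau f g h (quadratic_supply S11 S12 S22).
Proof.
(* The normalization at the zero history is the hypothesis [storage0], closed here by [//]. *)
exists (delay_storage tau S1 Theta); split => //.
- move=> phi psi phipsi; rewrite /delay_storage phipsi; last first.
    by rewrite in_itv/= lexx oppr_le0 ltW.
  congr (_ + _); apply: eq_bigr => i _; apply: eq_Rintegral => r.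
  rewrite inE/= in_itv/= => /andP[ri r0]; rewrite phipsi// in_itv/= r0 andbT.
  by rewrite (le_trans _ ri)// lerN2 tau_le_max.
- move=> phi _; rewrite addr_ge0// sumr_ge0// => i _.
  by apply: Rintegral_ge0 => r _; have [_] := Theta_psd i; exact.
- move=> phi u T x phi_C1 u_adm x_sol t0 t1 t0_ge0 t01 t1T.
  rewrite (delay_storage_increment tau_gt0 tau_mono f_lip g_lip S1_C1
    Theta_cont phi_C1 u_adm x_sol t0_ge0 t01 t1T).
  (* The increment is now an integral over [[t0, t1]], so a pointwise comparison with the supply
     suffices, even if the arbitrary [h] makes the supply nonmeasurable in time. *)
  apply: le_integral_nonmeasurable => t _; rewrite lee_fin.
  have := dissipation_mx_supply (u t) (LMI (x t) (delayed_states tau x t)).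
  apply: le_trans; rewrite lerD2l ler_sum// => i _.
  by rewrite (_ : col i _ = x (t - tau i))//; apply/colP => k; rewrite !mxE.
Qed.
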